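(* Let $X$ be an $n$-premaniplex and let $\xi:\Pi(X)\to\Gamma$ be a voltage assignment such that the derived graph $X^\xi$ is a maniplex. Then $X^\xi$ is the flag graph of a polytope if and only if $$\xi(\Pi^{x,y}_I(X))\cap\xi(\Pi^{x,y}_J(X))=\xi(\Pi^{x,y}_{I\cap J}(X))$$ for all $I,J\subset\{0,\dots,n-1\}$ and all vertices $x,y$ of $X$.
   Context: **Polytopes.** A poset is flagged if it has a least and a greatest element and all its maximal chains (flags) have the same finite cardinality, say $n+2$; it then has an order-preserving rank function onto $\{-1,0,\dots,n\}$. Two flags are $i$-adjacent if they differ exactly in their element of rank $i$. An (abstract) $n$-polytope is a flagged poset with rank function onto $\{-1,\dots,n\}$ such that (diamond condition) for each flag $\Phi$ and each $i\in\{0,\dots,n-1\}$ there is a unique flag that is $i$-adjacent to $\Phi$; and (strong flag connectedness) any two flags $\Phi,\Psi$ are joined by a sequence of flags, consecutive ones adjacent, all containing $\Phi\cap\Psi$. The flag graph of a polytope has the flags as vertices, with an edge of colour $i$ joining each pair of $i$-adjacent flags. An edge-coloured graph ''is the flag graph of a polytope'' if it is isomorphic, by a colour-preserving isomorphism, to the flag graph of some $n$-polytope. **Graphs.** Graphs may have parallel edges and semi-edges. Every edge consists of darts; a dart $d$ has an initial vertex, a terminal vertex and an inverse dart $d^{-1}$; an edge joining two different vertices (a link) consists of two mutually inverse darts, and a semi-edge consists of a single dart $d=d^{-1}$ with both ends at the same vertex. An $n$-premaniplex is a connected graph with edges coloured by $\{0,\dots,n-1\}$, all of whose edges are links or semi-edges,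 such that each vertex is incident to exactly one edge of each colour, and such that if $|i-j|>1$ every path of length $4$ alternating between colours $i$ and $j$ is closed. An $n$-maniplex is an $n$-regular connected simple graph (no semi-edges, no parallel edges) with a proper edge colouring with colours $\{0,\dots,n-1\}$ such that if $|i-j|>1$ the subgraph formed by edges of colours $i,j$ is a disjoint union of $4$-cycles. **Voltages.** A voltage assignment $\xi:\Pi(X)\to\Gamma$ into a group $\Gamma$ is a groupoid antimorphism from the fundamental groupoid of $X$; equivalently, it assigns to each dart $d$ an element $\xi(d)\in\Gamma$ with $\xi(d^{-1})=\xi(d)^{-1}$ and is extended to paths by $\xi(d_1d_2\cdots d_k)=\xi(d_k)\cdots\xi(d_1)$ (empty paths have trivial voltage). The derived graph $X^\xi$ has vertex set $V\times\Gamma$ and dart set $D\times\Gamma$ ($V$, $D$ the vertices and darts of $X$); the dart $(d,g)$, where $d$ goes from $x$ to $y$, goes from $(x,g)$ to $(y,\xi(d)g)$, has inverse $(d^{-1},\xi(d)g)$ and has the colour of $d$. For vertices $x,y$ and a set of colours $I$, $\Pi_I^{x,y}(X)$ is the set of (homotopy classes of) paths from $x$ to $y$ using only darts with colours in $I$, and $\xi(\Pi_I^{x,y}(X))\subset\Gamma$ is the set of voltages of all such paths. *)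

(* Defs.v *)
From HB Require Import structures.
From Stdlib Require List.
From mathcomp Require Import all_boot all_order all_algebra.
From mathcomp Require Import boolp classical_sets functions cardinality.

Set Implicit Arguments.
Unset Strict Implicit.
Unset Printing Implicit Defensive.

(* An edge is an orbit {d, dart_inv d}; parallel edges, semi-edges
   (dart_inv d = d) and loops are all possible. *)
Record cgraph (n : nat) := CGraph {
  vertex : Type;
  dart : Type;
  init : dart -> vertex;
  term : dart -> vertex;
  dart_inv : dart -> dart;
  colour : dart -> 'I_n;
  dart_invK : involutive dart_inv;
  init_inv : forall d, init (dart_inv d) = term d;
  colour_inv : forall d, colour (dart_inv d) = colour d }.

Arguments CGraph {n vertex dart init term dart_inv colour}.
Arguments init {n c}.
Arguments term {n c}.
Arguments dart_inv {n c}.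
Arguments colour {n c}.

Section Graphs.
Context {n : nat} (G : cgraph n).
Implicit Types (x y v : vertex G) (d e : dart G) (p : seq (dart G)).

Fixpoint walk x p y : Prop :=
  if p is d :: p' then init d = x /\ walk (term d) p' y else x = y.

Definition colours_in (I : {set 'I_n}) p : bool := all (fun d => colour d \in I) p.

(* Connected graphs are taken to be nonempty. *)
Definition connected : Prop :=
  inhabited (vertex G) /\ forall x y, exists p, walk x p y.

Definition link d : Prop := init d <> term d.
Definition semi_edge d : Prop := dart_inv d = d.
Definition same_edge d e : Prop := e = d \/ e = dart_inv d.
Definition incident d v : Prop := init d = v \/ term d = v.

(* |i - j| > 1, avoiding truncated subtraction *)
Definition far (i j : 'I_n) : bool := (i.+1 < j) || (j.+1 < i).

Definition is_premaniplex : Prop :=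
  [/\ connected,
      forall d, link d \/ semi_edge d,
      forall v (i : 'I_n), exists d,
        [/\ incident d v, colour d = i &
            forall e, incident e v -> colour e = i -> same_edge d e] &
      forall i j : 'I_n, far i j -> forall x y p, walk x p y ->
        [seq colour d | d <- p] = [:: i; j; i; j] -> x = y].

Definition simple : Prop :=
  (forall d, link d) /\
  (forall d e, init d = init e -> term d = term e -> d = e).

(* In a graph without loops and semi-edges, the edges at v correspond to the
   darts starting at v. *)
Definition regular (k : nat) : Prop :=
  forall v, ([set d | init d = v]%classic #= `I_k)%card.

Definition proper_colouring : Prop :=
  forall d e, init d = init e -> colour d = colour e -> d = e.

(* p traverses a 4-cycle that is a whole connected component of the subgraph
   formed by the edges with colours in I. *)
Definition four_cycle_component (I : {set 'I_n}) p : Prop :=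
  [/\ size p = 4, exists x, walk x p x, colours_in I p,
      List.NoDup [seq init d | d <- p] &
      forall d e, List.In d p -> init e = init d -> colour e \in I ->
        exists2 d', List.In d' p & same_edge d' e].

Definition is_maniplex : Prop :=
  [/\ connected, simple, regular n, proper_colouring &
      forall i j : 'I_n, far i j -> forall d, colour d \in [set i; j]%SET ->
        exists2 p, four_cycle_component [set i; j]%SET p & List.In d p].

End Graphs.

Definition cgraph_iso {n : nat} (G H : cgraph n) : Prop :=
  exists (f : vertex G -> vertex H) (g : dart G -> dart H),
    [/\ bijective f, bijective g &
        forall d, [/\ init (g d) = f (init d), term (g d) = f (term d),
                      g (dart_inv d) = dart_inv (g d) & colour (g d) = colour d]].

Record voltage {n : nat} (X : cgraph n) (Gamma : groupType) := Voltage {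
  volt :> dart X -> Gamma;
  volt_inv : forall d, volt (dart_inv d) = (volt d)^-1%g }.

Section Voltages.
Context {n : nat} {X : cgraph n} {Gamma : groupType} (xi : voltage X Gamma).

Fixpoint path_volt (p : seq (dart X)) : Gamma :=
  if p is d :: p' then (path_volt p' * xi d)%g else 1%g.

(* Voltages are invariant under homotopy, so walks stand for their homotopy
   classes. *)
Definition path_volts (I : {set 'I_n}) (x y : vertex X) : set Gamma :=
  [set g | exists p, [/\ walk x p y, colours_in I p & path_volt p = g]]%classic.

Let dvertex : Type := vertex X * Gamma.
Let ddart : Type := dart X * Gamma.
Let dinit (d : ddart) : dvertex := (init d.1, d.2).
Let dterm (d : ddart) : dvertex := (term d.1, (xi d.1 * d.2)%g).
Let dinv (d : ddart) : ddart := (dart_inv d.1, (xi d.1 * d.2)%g).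
Let dcol (d : ddart) : 'I_n := colour d.1.

Lemma derived_invK : involutive dinv.
Proof. by case=> d g; rewrite /dinv /= dart_invK volt_inv mulKg. Qed.

Lemma derived_init_inv d : dinit (dinv d) = dterm d.
Proof. by rewrite /dinit /dterm /= init_inv. Qed.

Lemma derived_col_inv d : dcol (dinv d) = dcol d.
Proof. exact: colour_inv. Qed.

Definition derived : cgraph n :=
  CGraph derived_invK derived_init_inv derived_col_inv.

End Voltages.

Section Polytopes.
Context {disp : Order.disp_t} {P : porderType disp}.

Definition chain (C : set P) : Prop := total_on C (fun x y => (x <= y)%O).

Definition is_flag (F : set P) : Prop :=
  chain F /\ forall C, chain C -> (F `<=` C)%classic -> C = F.

Definition flag : Type := {F : set P | is_flag F}.

Definition elts (F : flag) : set P := proj1_sig F.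

Definition flagged (n : nat) : Prop :=
  [/\ exists b : P, forall x, (b <= x)%O,
      exists t : P, forall x, (x <= t)%O &
      forall F : flag, (elts F #= `I_n.+2)%card].

(* Order preserving is meant strictly; in a poset satisfying [flagged n] this
   determines rk. *)
Definition rank_function (n : nat) (rk : P -> int) : Prop :=
  (forall x y, (x < y)%O -> (rk x < rk y)%R) /\
  range rk = [set k : int | (-1 <= k <= n%:Z)%R]%classic.

Definition adjacent (rk : P -> int) (i : nat) (F F' : flag) : Prop :=
  F <> F' /\ forall x, rk x <> (i%:Z)%R -> (elts F x <-> elts F' x).

Definition diamond (n : nat) (rk : P -> int) : Prop :=
  forall (F : flag) (i : 'I_n), exists! F', adjacent rk i F F'.

Definition strongly_flag_connected (n : nat) (rk : P -> int) : Prop :=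
  forall F F' : flag, exists (s : nat -> flag) (m : nat),
    [/\ s 0 = F, s m = F',
        forall k, k < m -> exists i : 'I_n, adjacent rk i (s k) (s k.+1) &
        forall k, k <= m -> (elts F `&` elts F' `<=` elts (s k))%classic].

Definition is_polytope (n : nat) (rk : P -> int) : Prop :=
  [/\ flagged n, rank_function n rk, diamond n rk &
      strongly_flag_connected n rk].

Lemma adjacent_sym rk i F F' : adjacent rk i F F' -> adjacent rk i F' F.
Proof.
by case=> nFF' FF'; split=> [/esym //|x rx]; apply: iff_sym; apply: FF'.
Qed.

End Polytopes.

Arguments flag {disp} P.

Section FlagGraph.
Context (n : nat) {disp : Order.disp_t} {P : porderType disp} (rk : P -> int).

Record flag_dart := FlagDart {
  fd_init : flag P;
  fd_term : flag P;
  fd_col : 'I_n;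
  fd_adj : adjacent rk fd_col fd_init fd_term }.

Definition flag_dart_inv (d : flag_dart) : flag_dart :=
  FlagDart (adjacent_sym (fd_adj d)).

Lemma flag_dart_invK : involutive flag_dart_inv.
Proof.
by case=> F F' i a; rewrite /flag_dart_inv /=; congr FlagDart; apply: Prop_irrelevance.
Qed.

Definition flag_graph : cgraph n :=
  @CGraph n (flag P) flag_dart fd_init fd_term flag_dart_inv fd_col
    flag_dart_invK (fun=> erefl) (fun=> erefl).

End FlagGraph.

Definition is_polytope_flag_graph {n : nat} (G : cgraph n) : Prop :=
  exists (disp : Order.disp_t) (P : porderType disp) (rk : P -> int),
    is_polytope n rk /\ cgraph_iso G (flag_graph n rk).

(* Main.v *)
(* A walk of the derived graph from (x, g) to (y, h) with colours in I exists iff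
   h g^-1 is the voltage of such a walk of X from x to y, so the condition on
   voltages says that two vertices joined both by an I-path and by a J-path are
   joined by an (I :&: J)-path. It remains to characterise by this property the
   maniplexes M that are flag graphs of polytopes.
   In a polytope, flags joined by an I-path and a J-path share their faces of
   rank outside I :&: J, and strong connectedness gives an (I :&: J)-path.
   Conversely, take as faces of rank i the connected components of M without
   the edges of colour i, two faces being incident when they meet. As colours i
   and j with |i - j| > 1 commute, a path avoiding colour k can be rearranged to
   use the colours above k before those below; hence incidence is transitive and
   every flag consists of the faces through some vertex. The intersection
   property makes this vertex unique and yields the polytope axioms. *)
Require Import Defs.
From mathcomp Require Import all_boot all_order all_algebra.
From mathcomp Require Import boolp classical_sets functions cardinality.
From HB Require Import structures.
From mathcomp Require Import zify.

Set Implicit Arguments.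
Unset Strict Implicit.
Unset Printing Implicit Defensive.

Import Order.TTheory.

(** Composing [f] with an enumeration of [A] gives an injective self-map of ['I_m], which is
    bijective. *)
Lemma set_inj_onto_ord (T : Type) (A : set T) m (f : T -> 'I_m) :
  (A #= `I_m)%card -> set_inj A f -> forall i, exists2 x, A x & f x = i.
Proof.
move=> /card_set_bijP[h [_ _ h_surj]] f_inj i.
have /choice[e he] (j : 'I_m) : exists x, A x /\ h x = j.
  by have [x Ax hx] := h_surj j (ltn_ord j); exists x.
have fe_inj : injective (f \o e).
  move=> j k /(f_inj _ _ (mem_set (he j).1) (mem_set (he k).1)) ejk.
  by apply: val_inj; rewrite /= -(he j).2 -(he k).2 ejk.
have [fe' _ fe'K] := injF_bij fe_inj.
by exists (e (fe' i)); [exact: (he _).1 | exact: fe'K].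
Qed.

(** * Reachability by paths with prescribed colours *)

Section Reachability.
Context {n : nat} (G : cgraph n).
Implicit Types (u v w : vertex G) (d : dart G) (I J : {set 'I_n}).

Lemma term_inv d : term (dart_inv d) = init d.
Proof. by rewrite -init_inv dart_invK. Qed.

Definition reach I u v : Prop := exists2 p, walk u p v & colours_in I p.

Lemma reach_refl I u : reach I u u.
Proof. by exists [::]. Qed.

Lemma reach_cons I d v : colour d \in I -> reach I (term d) v -> reach I (init d) v.
Proof. by move=> dI [p wp pI]; exists (d :: p); rewrite //= dI. Qed.

Lemma reach_dart I d : colour d \in I -> reach I (init d) (term d).
Proof. by move=> dI; apply: (reach_cons dI); apply: reach_refl. Qed.

Lemma reach_ind I v (Q : vertex G -> Prop) :
  Q v ->
  (forall d, colour d \in I -> reach I (term d) v -> Q (term d) -> Q (init d)) ->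
  forall u, reach I u v -> Q u.
Proof.
move=> Qv Qd u [p]; elim: p u => [|d p IHp] u /=; first by move->.
case=> <- wp /andP[dI pI]; apply: Qd => //; first by exists p.
exact: IHp.
Qed.

Lemma reach_trans I u v w : reach I u v -> reach I v w -> reach I u w.
Proof.
by move=> uv vw; elim/reach_ind: u / uv => // d dI _; apply: reach_cons.
Qed.

Lemma reach_sym I u v : reach I u v -> reach I v u.
Proof.
move=> uv; elim/reach_ind: u / uv; first exact: reach_refl.
move=> d dI _ vd; apply: reach_trans vd _.
by rewrite -init_inv -(term_inv d); apply: reach_dart; rewrite colour_inv.
Qed.

Lemma reach_sub I J u v : I \subset J -> reach I u v -> reach J u v.
Proof.
move=> IJ uv; elim/reach_ind: u / uv; first exact: reach_refl.
by move=> d dI _; apply: reach_cons; apply: (fintype.subsetP IJ).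
Qed.

Definition path_intersection : Prop :=
  forall I J u v, reach I u v -> reach J u v -> reach (I :&: J) u v.

(** The binary property removes one colour of [s] at a time; this merges agreement rank by rank into
    a single path. *)
Lemma path_intersection_all (s : seq 'I_n) I u v : path_intersection ->
  reach I u v -> (forall i, i \in s -> reach [set~ i] u v) ->
  reach (I :\: [set i in s]) u v.
Proof.
move=> pi uv; elim: s => [_|i s IHs s_uv].
  by apply: reach_sub uv; apply/fintype.subsetP => i; rewrite !inE.
have := pi _ _ _ _ (IHs _) (s_uv i (mem_head _ _)).
move=> /(_ (fun j js => s_uv j (mem_behead (s := i :: s) js))).
apply: reach_sub; apply/fintype.subsetP => j; rewrite !inE.
by case: eqP => //= _ /andP[].
Qed.

End Reachability.

Lemma flag_eq disp (P : porderType disp) (F F' : flag P) :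
  (elts F `<=` elts F')%classic -> F = F'.
Proof.
case: F F' => F Fflag [F' F'flag] /= FF'.
have e := Fflag.2 _ F'flag.1 FF'; subst F'.
by congr exist; apply: Prop_irrelevance.
Qed.

Lemma flag_dart_eq n disp (P : porderType disp) (rk : P -> int)
    (d e : flag_dart n rk) :
  fd_init d = fd_init e -> fd_term d = fd_term e -> fd_col d = fd_col e -> d = e.
Proof.
case: d e => F F' i dF [G G' j eG] /= FG FG' ij; subst.
by congr FlagDart; apply: Prop_irrelevance.
Qed.

(** * Maniplexes and commuting colours *)

Record maniplex (n : nat) := Maniplex {
  mgraph :> cgraph n;
  maniplexP : is_maniplex mgraph }.

Section Maniplex.
Context {n : nat} (M : maniplex n).
Implicit Types (u v w : vertex M) (d e : dart M) (I : {set 'I_n}).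

Lemma maniplex_link d : init d <> term d.
Proof. by have [_ [+ _] _ _ _] := maniplexP M; apply. Qed.

Lemma maniplex_proper d e : init d = init e -> colour d = colour e -> d = e.
Proof. by have [_ _ _ + _] := maniplexP M; apply. Qed.

Lemma maniplex_dart v (i : 'I_n) : exists2 d, init d = v & colour d = i.
Proof.
have [_ _ reg _ _] := maniplexP M.
apply: (set_inj_onto_ord (reg v)) => d e /set_mem dv /set_mem ev.
by apply: maniplex_proper; rewrite dv ev.
Qed.

Lemma maniplex_connected u v : reach [set: 'I_n] u v.
Proof.
have [[_ /(_ u v)[p wp]] _ _ _ _] := maniplexP M.
by exists p => //; elim: p {wp} => //= d p ->; rewrite inE.
Qed.

(** Only one dart of each colour leaves a vertex, so a one-coloured path shuttles between the ends
    of [d]. *)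
Lemma reach_set1 d v :
  reach [set colour d] (init d) v -> v = init d \/ v = term d.
Proof.
move=> /reach_sym; move: v; apply: reach_ind => [|e + _]; first by left.
rewrite inE => /eqP ed [e_init|e_term].
  right; have <- : dart_inv e = d.
    by apply: maniplex_proper; rewrite ?init_inv ?colour_inv.
  by rewrite term_inv.
left; suff -> : e = d by [].
apply: (can_inj (@dart_invK _ M)).
by apply: maniplex_proper; rewrite ?init_inv ?colour_inv.
Qed.

(** Repeating a colour means turning back, which would identify opposite vertices, so the colours
    alternate; the other way round the cycle runs along the inverses of [d4] and [d3]. *)
Lemma four_cycle_swap d1 d2 d3 d4 :
  far (colour d1) (colour d2) -> term d1 = init d2 -> term d2 = init d3 ->
  term d3 = init d4 -> term d4 = init d1 ->
  init d1 <> init d3 -> init d2 <> init d4 ->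
  colours_in [set colour d1; colour d2] [:: d3; d4] ->
  exists e1 e2, [/\ colour e1 = colour d2, colour e2 = colour d1,
    init e1 = init d1, term e1 = init e2 & term e2 = term d2].
Proof.
move=> d12 t1 t2 t3 t4 n13 n24; rewrite /= !inE andbT => /andP[d3c d4c].
have nstep d e : init e = term d -> colour e = colour d -> term e = init d.
  move=> de ce; have -> : e = dart_inv d.
    by apply: maniplex_proper; rewrite ?init_inv ?colour_inv.
  exact: term_inv.
have c3 : colour d3 = colour d1.
  case/orP: d3c => /eqP // c3; case: n24.
  by rewrite -t3 (nstep d2 d3).
have c4 : colour d4 = colour d2.
  case/orP: d4c => /eqP // c4; case: n13.
  by rewrite -t4 (nstep d3 d4) // c3.
exists (dart_inv d4), (dart_inv d3).
by rewrite !colour_inv !init_inv !term_inv.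
Qed.

Lemma maniplex_swap d1 d2 : far (colour d1) (colour d2) -> term d1 = init d2 ->
  exists e1 e2, [/\ colour e1 = colour d2, colour e2 = colour d1,
    init e1 = init d1, term e1 = init e2 & term e2 = term d2].
Proof.
move=> d12 t12; have [_ _ _ _ cyc] := maniplexP M.
have [p [sz_p [x wp] pc Np _] d1p] := cyc _ _ d12 d1 (set21 _ _).
(* This treats the cycle read from [d1]: its second dart must be [d2], since one of the colour of
   [d1] would turn back. *)
have key a b c : term d1 = init a -> term a = init b -> term b = init c ->
    term c = init d1 -> init d1 <> init b -> init a <> init c ->
    colours_in [set colour d1; colour d2] [:: a; b; c] ->
  exists e1 e2, [/\ colour e1 = colour d2, colour e2 = colour d1,
    init e1 = init d1, term e1 = init e2 & term e2 = term d2].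
  move=> t1 t2 t3 t4 n13 n24; rewrite {1}/colours_in /= andbA andbC andbCA.
  move=> /and3P[a_c b_c c_c].
  suff ad : a = d2.
    by subst a; apply: (four_cycle_swap d12 t1 t2 t3 t4 n13 n24); rewrite /= c_c b_c.
  apply: maniplex_proper; first by rewrite -t1.
  move: a_c; rewrite !inE => /orP[] /eqP // a_c; case: n13.
  rewrite -t2; have -> : a = dart_inv d1; last by rewrite term_inv.
  by apply: maniplex_proper; rewrite ?init_inv ?colour_inv.
case: p sz_p wp pc Np d1p => [|a [|b [|c [|d [|]]]]] //= _.
case=> ax [ab [bc [cd dx]]]; rewrite /colours_in /= => /and5P[Ca Cb Cc Cd _] N.
have {N} [] : [/\ init a <> init c & init b <> init d].
  move: N => /List.NoDup_cons_iff[/= na /List.NoDup_cons_iff[/= nb _]].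
  by split=> e; [apply: na | apply: nb]; rewrite e; tauto.
(* [d1] may stand at any of the four places of [p], so the cycle is rotated. *)
move=> nac nbd; case=> [|[|[|[|[]]]]] ed; subst d1;
  [apply: (key b c d) | apply: (key c d a) | apply: (key d a b) | apply: (key a b c)];
  by rewrite /colours_in /= ?Ca ?Cb ?Cc ?Cd //; congruence.
Qed.

(** Swapping [d] with each dart of the path in turn carries it to the far end. *)
Lemma reach_slide I d w : (forall i, i \in I -> far (colour d) i) ->
  reach I (term d) w ->
  exists d', [/\ colour d' = colour d, reach I (init d) (init d') & term d' = w].
Proof.
(* Each swap replaces the dart, so the induction on the path must quantify over [d]. *)
move=> + dw; have := erefl (term d).
move: {1 3}(term d) dw => u uw; move: u uw d.
apply: reach_ind => [d <- _|e eI _ IH d td dI].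
  by exists d; split=> //; apply: reach_refl.
have [e1 [e2 [c1 c2 i1 t1 t2]]] := maniplex_swap (dI _ eI) td.
have [|f [cf rf tf]] := IH e2 t2; first by rewrite c2.
exists f; split=> //; first by rewrite cf c2.
by rewrite -i1; apply: reach_cons; rewrite ?c1 // t1.
Qed.

(** * Faces as components, ordered by incidence *)

Definition avoiding (k : nat) : {set 'I_n} := [set c : 'I_n | c.+1 != k].

(** Colours on different sides of the missing one differ by more than 1, so a dart of low colour
    slides past all the high ones. *)
Lemma reach_split k u v : reach (avoiding k) u v ->
  exists2 w, reach [set c : 'I_n | k < c.+1] u w
           & reach [set c : 'I_n | c.+1 < k] w v.
Proof.
move: u; apply: reach_ind => [|d + _ [w dw wv]].
  by exists v; apply: reach_refl.
rewrite inE neq_ltn => /orP[] dk; last first.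
  by exists w => //; apply: reach_cons; rewrite ?inE.
have [i|d' [cd' rd' td']] := reach_slide _ dw.
  by rewrite inE /far; lia.
by exists (init d') => //; apply: reach_cons; rewrite ?inE ?cd' ?td'.
Qed.

(* The rank in {-1, ..., n} is shifted by one in frank: colour c is the rank
   c.+1, and the two improper faces, of ranks 0 and n.+1, avoid no colour. *)
Record face := Face {
  frank : 'I_n.+2;
  fvertices : set (vertex M);
  face_class : exists v, fvertices = [set u | reach (avoiding frank) v u]%classic }.

Definition face_at (k : 'I_n.+2) v : face := @Face k _ (ex_intro _ v erefl).

(** Equivalent to [fvertices A v], but in the form of an equation, which can be rewritten with. *)
Definition face_mem v (A : face) : Prop := A = face_at (frank A) v.

Lemma face_at_eq k u v : face_at k u = face_at k v <-> reach (avoiding k) u v.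
Proof.
split=> [[uv]|uv].
  have : [set w | reach (avoiding k) v w]%classic v by apply: reach_refl.
  by rewrite -uv.
suff e : [set w | reach (avoiding k) u w]%classic =
    [set w | reach (avoiding k) v w]%classic.
  rewrite /face_at; move: (ex_intro _ u _) (ex_intro _ v _) => /=.
  by rewrite e => p q; congr Face; apply: Prop_irrelevance.
apply/seteqP; split=> w /=; apply: reach_trans => //.
exact: reach_sym.
Qed.

Lemma face_at_mem k v : face_mem v (face_at k v).
Proof. by []. Qed.

Lemma face_ex_mem (A : face) : exists v, face_mem v A.
Proof.
case: A => k A [v Av]; exists v; subst A; rewrite /face_mem /face_at.
by congr Face; apply: Prop_irrelevance.
Qed.

Lemma face_mem_eq v (A B : face) :
  face_mem v A -> face_mem v B -> frank A = frank B -> A = B.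
Proof. by move=> -> -> /= ->. Qed.

Lemma face_mem_reach (A : face) I u v : I \subset avoiding (frank A) ->
  reach I u v -> face_mem u A -> face_mem v A.
Proof.
move=> IA uv uA; rewrite /face_mem {1}uA; apply/face_at_eq.
exact: reach_sub uv.
Qed.

Lemma face_mem_reachable (A : face) u v :
  face_mem u A -> face_mem v A -> reach (avoiding (frank A)) u v.
Proof. by move=> uA vA; apply/face_at_eq; rewrite -uA -vA. Qed.

Definition face_le (A B : face) : bool :=
  (frank A <= frank B) && `[< exists v, face_mem v A /\ face_mem v B >].

(* A path from u to v in B can be rearranged to use the colours above the rank
   of B first; these preserve the faces of lower rank, and the remaining ones
   preserve C. *)
Lemma face_meet (B C : face) u v : frank B <= frank C ->
  face_mem u B -> face_mem v B -> face_mem v C ->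
  exists2 w, face_mem w C
           & forall A, frank A <= frank B -> face_mem u A -> face_mem w A.
Proof.
move=> BC uB vB vC.
have [w uw wv] := reach_split (face_mem_reachable uB vB).
exists w => [|A AB uA].
  apply: face_mem_reach (reach_sym wv) vC.
  by apply/fintype.subsetP => c; rewrite !inE; lia.
by apply: face_mem_reach uw uA; apply/fintype.subsetP => c; rewrite !inE; lia.
Qed.

Lemma face_le_refl : reflexive face_le.
Proof.
move=> A; rewrite /face_le leqnn; apply/asboolP.
by have [v] := face_ex_mem A; exists v.
Qed.

Lemma face_le_anti : antisymmetric face_le.
Proof.
move=> A B /andP[/andP[AB /asboolP[v [vA vB]]] /andP[BA _]].
by apply: (face_mem_eq vA vB); apply: val_inj; apply/eqP; rewrite eqn_leq AB.
Qed.

(** [face_meet] moves a common vertex of [A] and [B] into [C] without leaving [A]. *)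
Lemma face_le_trans : transitive face_le.
Proof.
move=> B A C /andP[AB /asboolP[u [uA uB]]] /andP[BC /asboolP[v [vB vC]]].
have [w wC uw] := face_meet BC uB vB vC.
rewrite /face_le (leq_trans AB BC); apply/asboolP.
by exists w; split; first exact: uw.
Qed.

HB.instance Definition _ := gen_eqMixin face.
HB.instance Definition _ := gen_choiceMixin face.
HB.instance Definition _ := Order.Le_isPOrder.Build (Order.Disp tt tt) face
  face_le_refl face_le_anti face_le_trans.

Lemma face_leE (A B : face) :
  (A <= B)%O = (frank A <= frank B) && `[< exists v, face_mem v A /\ face_mem v B >].
Proof. by []. Qed.

Lemma face_le_mem v (A B : face) :
  face_mem v A -> face_mem v B -> frank A <= frank B -> (A <= B)%O.
Proof. by move=> vA vB AB; rewrite face_leE AB; apply/asboolP; exists v. Qed.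

(** Distinct components for the same colours are disjoint, while comparable faces meet. *)
Lemma face_comparable_eq (A B : face) :
  (A <= B)%O \/ (B <= A)%O -> frank A = frank B -> A = B.
Proof.
rewrite !face_leE => -[]/andP[_ /asboolP[v [vA vB]]] AB.
  exact: face_mem_eq vA vB AB.
exact: face_mem_eq vB vA AB.
Qed.

Lemma face_lt_rank (A B : face) : (A < B)%O -> frank A < frank B.
Proof.
rewrite lt_neqAle => /andP[neAB leAB].
have := leAB; rewrite face_leE => /andP[rAB _].
rewrite ltn_neqAle rAB andbT; apply: contraNN neAB => /eqP eAB; apply/eqP.
by apply: face_comparable_eq (val_inj eAB); left.
Qed.

Lemma face_mem_bot v (A : face) : frank A = 0 :> nat -> face_mem v A.
Proof.
have [u uA] := face_ex_mem A => A0.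
apply: face_mem_reach (maniplex_connected u v) uA.
by apply/fintype.subsetP => c; rewrite !inE A0.
Qed.

Lemma face_mem_top v (A : face) : frank A = n.+1 :> nat -> face_mem v A.
Proof.
have [u uA] := face_ex_mem A => An.
apply: face_mem_reach (maniplex_connected u v) uA.
by apply/fintype.subsetP => c; rewrite !inE An; have := ltn_ord c; lia.
Qed.

(** * Flags of the face poset *)

Definition flag_at_set v : set face := [set A | face_mem v A]%classic.

Lemma flag_at_chain v : chain (flag_at_set v).
Proof.
by move=> A B vA vB; case/orP: (leq_total (frank A) (frank B)) => AB; [left|right];
  [exact: face_le_mem vA vB AB | exact: face_le_mem vB vA AB].
Qed.

(** A face comparable with the face of its own rank through [v] equals it, so nothing can be added
    to the chain. *)
Lemma flag_atP v : is_flag (flag_at_set v).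
Proof.
split=> [|C chC vC]; first exact: flag_at_chain.
apply/seteqP; split=> // A CA; rewrite /flag_at_set /= /face_mem.
by apply: face_comparable_eq => //; apply: chC => //; apply: vC.
Qed.

Definition flag_at v : flag face := exist _ _ (flag_atP v).

Lemma mem_flag_at v A : elts (flag_at v) A <-> face_mem v A.
Proof. by []. Qed.

(** The vertex is found by induction on the rank: at a face [B] of the chain of rank [m],
    [face_meet] moves it into [B] without leaving the lower faces. *)
Lemma chain_common_vertex (C : set face) : chain C ->
  exists v, forall A, C A -> face_mem v A.
Proof.
move=> chC; have [[[u0] _] _ _ _ _] := maniplexP M.
(* [A0] is the highest face of the chain met so far, or a least face if there is none yet; [n.+2]
   exceeds every shifted rank. *)
suff /(_ n.+2)[A0 [v [_ _ Cv]]] m : exists A0 v, [/\ face_mem v A0,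
    forall B, C B -> m <= frank B -> (A0 <= B)%O &
    forall A, C A -> frank A < m -> frank A <= frank A0 /\ face_mem v A].
  by exists v => A CA; have [] := Cv A CA (ltn_ord _).
elim: m => [|m [A0 [v [vA0 A0le Cv]]]].
  exists (face_at ord0 u0), u0; split=> // B _ _.
  have [v vB] := face_ex_mem B.
  by apply: (face_le_mem (v := v)) => //; apply: face_mem_bot.
have [[B [CB Bm]]|noB] := EM (exists B, C B /\ frank B = m :> nat); last first.
  exists A0, v; split=> // [B CB mB|A CA Am]; first exact: A0le (ltnW mB).
  apply: Cv => //; rewrite ltn_neqAle -ltnS Am andbT.
  by apply/eqP => Am'; apply: noB; exists A.
have := A0le B CB; rewrite Bm leqnn face_leE.
move=> /(_ isT)/andP[A0B /asboolP[u [uA0 uB]]].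
have [w wB vw] := face_meet A0B vA0 uA0 uB.
have CBle A : C A -> frank A < m.+1 -> A = B \/ frank A < m.
  move=> CA; rewrite ltnS leq_eqVlt => /orP[/eqP Am|]; last by right.
  left; apply: face_comparable_eq; first exact: chC.
  by apply: val_inj; rewrite /= Am Bm.
exists B, w; split=> // [B' CB' mB'|A CA Am].
  have [//|] := chC _ _ CB CB'; rewrite face_leE => /andP[B'B _]; lia.
have [->//|Am'] := CBle A CA Am; have [AA0 vA] := Cv A CA Am'.
by split; [rewrite Bm ltnW | apply: vw].
Qed.

Lemma flag_at_surj (F : flag face) : exists v, F = flag_at v.
Proof.
have [v Fv] := chain_common_vertex (proj2_sig F).1.
by exists v; apply: flag_eq.
Qed.

Definition face_rk (A : face) : int := ((frank A)%:Z - 1)%R.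

(** The faces of rank [i] are the components of the graph without colour [i]. *)
Lemma flag_at_agree u v (i : 'I_n) :
  (forall A, face_rk A = (i%:Z)%R -> face_mem u A <-> face_mem v A) <->
  reach [set~ i] u v.
Proof.
have ai : avoiding (inord i.+1 : 'I_n.+2) = [set~ i].
  by apply/setP => c; rewrite !inE inordK ?ltnS ?(ltnW (ltn_ord _)).
split=> [uv|uv A].
  rewrite -ai; apply/face_at_eq.
  have [|+ _] := uv (face_at (inord i.+1) u).
    by rewrite /face_rk /= inordK ?ltnS ?(ltnW (ltn_ord _)) //; lia.
  by move=> /(_ (face_at_mem _ _)).
rewrite /face_rk => Ai; have iA : [set~ i] \subset avoiding (frank A).
  by apply/fintype.subsetP => c; rewrite !inE -val_eqE /=; lia.
by split; apply: face_mem_reach iA _; [|apply: reach_sym].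
Qed.

(** * Polytope axioms from the intersection property *)

Section PathIntersection.
Hypothesis pi : path_intersection M.

(** Each rank outside [I] gives a path avoiding that colour, and [path_intersection_all] combines
    these. *)
Lemma reach_flag_at I u v :
  (forall i : 'I_n, i \notin I ->
    forall A, face_rk A = (i%:Z)%R -> face_mem u A <-> face_mem v A) ->
  reach I u v.
Proof.
move=> uv.
have : reach ([set: 'I_n] :\: [set i in enum (~: I)]) u v.
  apply: path_intersection_all => // [|i]; first exact: maniplex_connected.
  by rewrite mem_enum inE => iI; apply/flag_at_agree/uv.
apply: reach_sub; apply/fintype.subsetP => i.
by rewrite !inE mem_enum inE negbK andbT.
Qed.

(** For [I] empty, [reach_flag_at] leaves only the empty path. *)
Lemma flag_at_inj : injective flag_at.
Proof.
move=> u v uv; have [|p] := @reach_flag_at finset.set0 u v.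
  move=> i _ A _; rewrite -!mem_flag_at uv //.
by case: p => //= d p _; rewrite inE.
Qed.

Lemma flag_at_adjacent_term d :
  adjacent face_rk (colour d) (flag_at (init d)) (flag_at (term d)).
Proof.
split=> [/flag_at_inj|A]; first exact: maniplex_link.
move=> rkA; have dA : [set colour d] \subset avoiding (frank A).
  apply/fintype.subsetP => c; rewrite !inE => /eqP ->.
  by apply/eqP => e; apply: rkA; rewrite /face_rk -e; lia.
rewrite !mem_flag_at; have dd : reach [set colour d] (init d) (term d).
  by apply: reach_dart; rewrite inE.
by split; apply: face_mem_reach dA _; last apply: reach_sym.
Qed.

(** Agreement in all other ranks yields a path in the single colour of [d], which stops at an end of
    [d]. *)
Lemma flag_at_adjacent d v :
  adjacent face_rk (colour d) (flag_at (init d)) (flag_at v) -> v = term d.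
Proof.
case=> ne dv; have [|e|//] := @reach_set1 d v; last by case: ne; rewrite e.
apply: reach_flag_at => i; rewrite inE => /eqP id A rkA.
by apply: dv; rewrite rkA => -[/val_inj].
Qed.

Lemma maniplex_diamond : diamond n face_rk.
Proof.
move=> F i; have [v ->] := flag_at_surj F; have [d <- <-] := maniplex_dart v i.
exists (flag_at (term d)); split=> [|F']; first exact: flag_at_adjacent_term.
by have [w ->] := flag_at_surj F'; move=> /flag_at_adjacent ->.
Qed.

Lemma maniplex_flagged : flagged n (P := face).
Proof.
have [[[v] _] _ _ _ _] := maniplexP M; split.
- exists (face_at ord0 v) => A; have [u uA] := face_ex_mem A.
  by apply: (face_le_mem (v := u)) => //; apply: face_mem_bot.
- exists (face_at ord_max v) => A; have [u uA] := face_ex_mem A.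
  by apply: (face_le_mem (v := u)); rewrite -1?ltnS //; apply: face_mem_top.
move=> F; have [u ->] := flag_at_surj F.
(* The flag has exactly one face of each of the [n.+2] shifted ranks. *)
have -> : elts (flag_at u) = [set face_at (inord k) u | k in `I_n.+2]%classic.
  apply/seteqP; split=> [A uA|_ [k _ <-]]; last exact: face_at_mem.
  by exists (frank A) => /=; rewrite ?inord_val -?uA.
apply: inj_card_eq => j k /set_mem/= jn /set_mem/= kn [/(congr1 val)/=].
by rewrite !inordK.
Qed.

Lemma maniplex_rank : rank_function n face_rk.
Proof.
have [[[v] _] _ _ _ _] := maniplexP M; split=> [A B /face_lt_rank|].
  by rewrite /face_rk; lia.
apply/seteqP; split=> k /=; [case=> A _ <-|].
  by rewrite /face_rk; have := ltn_ord (frank A); lia.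
case/andP => k0 kn; exists (face_at (inord (absz (k + 1)%R)) v) => //.
by rewrite /face_rk /= inordK; lia.
Qed.

(** A path in the colours where the two flags differ never changes a face that they share. *)
Lemma maniplex_sfc : strongly_flag_connected n face_rk.
Proof.
move=> F F'; have [u ->] := flag_at_surj F; have [v ->] := flag_at_surj F'.
pose I := [set i : 'I_n |
  `[< ~ forall A, face_rk A = (i%:Z)%R -> face_mem u A <-> face_mem v A>]].
have : reach I u v.
  by apply: reach_flag_at => i; rewrite inE => /asboolPn/contrapT.
set K := (elts (flag_at u) `&` elts (flag_at v))%classic => uv.
have Kmem d : colour d \in I ->
    (K `<=` face_mem (init d) -> K `<=` face_mem (term d))%classic.
  move=> dI Kd A KA; apply: face_mem_reach (reach_dart (set11 _)) (Kd _ KA).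
  apply/fintype.subsetP => c; rewrite !inE => /eqP ->; apply/eqP => dA.
  move: dI; rewrite inE => /asboolP[] B; rewrite /face_rk => Bd.
  have BA : frank B = frank A by apply: val_inj; rewrite /= -dA; lia.
  have [uA vA] := KA.
  by split=> H; [rewrite (face_mem_eq H uA) | rewrite (face_mem_eq H vA)].
have : (K `<=` face_mem u)%classic by move=> A [].
(* Only the start of the path varies: [I] and [K] stay those of the original flags, and [K] lies in
   every flag on the way. *)
move: {1 2 3}u uv; apply: reach_ind => [Kv|d dI _ IH Kd].
  by exists (fun=> flag_at v), 0; split.
have [s [m [s0 sm sadj sK]]] := IH (Kmem _ dI Kd).
exists (fun k => if k is k'.+1 then s k' else flag_at (init d)), m.+1; split=> //.
- by case=> [_|k km]; [exists (colour d); rewrite s0 | exact: sadj];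
    exact: flag_at_adjacent_term.
- by case=> [_|k km]; [exact: Kd | exact: sK].
Qed.

Lemma maniplex_polytope : is_polytope n face_rk.
Proof.
by split; [exact: maniplex_flagged | exact: maniplex_rank
  | exact: maniplex_diamond | exact: maniplex_sfc].
Qed.

Lemma maniplex_iso_flag_graph : cgraph_iso M (flag_graph n face_rk).
Proof.
exists flag_at, (fun d => FlagDart (flag_at_adjacent_term d)); split.
- rewrite -setTT_bijective; split=> //; first by move=> u v _ _; apply: flag_at_inj.
  by move=> F _; have [v ->] := flag_at_surj F; exists v.
- rewrite -setTT_bijective; split=> //.
    move=> d e _ _ de; apply: maniplex_proper; last first.
      exact: (congr1 (@fd_col _ _ _ face_rk) de).
    by apply: flag_at_inj; exact: (congr1 (@fd_init _ _ _ face_rk) de).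
  case=> F F' i FF' _ /=.
  have [u uF] := flag_at_surj F; have [v vF] := flag_at_surj F'; subst.
  have [d du di] := maniplex_dart u i; subst.
  have vd := flag_at_adjacent FF'; subst.
  by exists d => //; apply: flag_dart_eq.
move=> d; split=> //=.
by apply: flag_dart_eq; rewrite /= ?init_inv ?term_inv ?colour_inv.
Qed.

End PathIntersection.

End Maniplex.

(** * Intersection property of the flag graph of a polytope *)

Section FlagGraphOfPolytope.
Context {n : nat} {disp : Order.disp_t} {P : porderType disp} (rk : P -> int).
Hypothesis polyP : is_polytope n rk.

Lemma flag_comparable_lt (F : flag P) x y :
  elts F x -> elts F y -> [\/ x = y, (x < y)%O | (y < x)%O].
Proof.
move=> Fx Fy; have [/(_ _ _ Fx Fy) + _] := proj2_sig F.
have [->|xy] := eqVneq x y; first by constructor 1.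
by case=> le; [constructor 2 | constructor 3]; rewrite lt_neqAle le ?xy // eq_sym xy.
Qed.

Lemma flag_rank_inj (F : flag P) x y : elts F x -> elts F y -> rk x = rk y -> x = y.
Proof.
have [_ [rk_lt _] _ _] := polyP => Fx Fy rxy.
by have [//|/rk_lt|/rk_lt] := flag_comparable_lt Fx Fy; rewrite rxy ltxx.
Qed.

(** The [n.+2] elements of a flag have distinct ranks among [n.+2] possible values, so every rank
    occurs. *)
Lemma flag_rank_onto (F : flag P) (i : 'I_n) : exists2 x, elts F x & rk x = (i%:Z)%R.
Proof.
have [[_ _ cardF] [_ rkR] _ _] := polyP.
have rk_bound x : (-1 <= rk x <= n%:Z)%R.
  suff : range rk (rk x) by rewrite rkR.
  by exists x.
have [|x Fx /(congr1 val)] := @set_inj_onto_ord _ _ _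
    (fun x => inord (absz (rk x + 1)%R) : 'I_n.+2) (cardF F) _ (inord i.+1).
  move=> x y /set_mem Fx /set_mem Fy /(congr1 val) /=.
  have := rk_bound x; have := rk_bound y; move=> bx by'.
  rewrite !inordK; [move=> e| lia | lia].
  by apply: (flag_rank_inj Fx Fy); lia.
have := rk_bound x; have := ltn_ord i => lin bx.
by rewrite /= !inordK; [move=> e; exists x => //; lia | lia | lia].
Qed.

(** Adjacent flags agree in the other ranks, so a common element of rank [i] would make them
    equal. *)
Lemma adjacent_rank (F F' : flag P) (i : 'I_n) x :
  adjacent rk i F F' -> elts F x -> elts F' x -> rk x <> (i%:Z)%R.
Proof.
case=> neFF' FF' Fx F'x rkx; apply: neFF'; apply: flag_eq => y Fy.
have [ryi|/eqP/FF'[/(_ Fy)]//] := eqVneq (rk y) (i%:Z)%R.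
by rewrite (flag_rank_inj Fy Fx) // rkx.
Qed.

Lemma reach_flag_graph_agree (I : {set 'I_n}) (F F' : vertex (flag_graph n rk)) x :
  reach I F F' -> (forall i, i \in I -> rk x <> (i%:Z)%R) -> elts F x -> elts F' x.
Proof.
move=> + xI; move: F; apply: reach_ind => // -[F1 F2 i F12] /= iI _ IH F1x.
by apply: IH; apply/(F12.2 _ (xI i iI)).
Qed.

(** For [i] outside [I :&: J], one of the two paths avoids [i], so [F] and [F'] share an element of
    rank [i]; the sequence from strong connectedness keeps it and hence never uses colour [i]. *)
Lemma flag_graph_path_intersection : path_intersection (flag_graph n rk).
Proof.
move=> I J F F' IFF' JFF'; have [_ _ _ sfc] := polyP.
have [s [m [s0 sm sadj sK]]] := sfc F F'.
have common (i : 'I_n) : i \notin I :&: J ->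
    exists x, (elts F `&` elts F')%classic x /\ rk x = (i%:Z)%R.
  have [x Fx xi] := flag_rank_onto F i; rewrite inE negb_and => iIJ.
  exists x; split=> //; split=> //; case/orP: iIJ => iI.
    apply: (reach_flag_graph_agree IFF') Fx => j jI.
    by rewrite xi => -[/val_inj ij]; rewrite ij jI in iI.
  apply: (reach_flag_graph_agree JFF') Fx => j jI.
    by rewrite xi => -[/val_inj ij]; rewrite ij jI in iI.
suff sreach k : k <= m -> reach (I :&: J) (F : vertex (flag_graph n rk)) (s k).
  by rewrite -sm; apply: sreach.
elim: k => [_|k IHk km]; first by rewrite s0; apply: reach_refl.
apply: reach_trans (IHk (ltnW km)) _; have [i adj] := sadj k km.
apply: (@reach_dart _ (flag_graph n rk) _ (FlagDart adj)); rewrite /=.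
apply: contrapT => /negP/common[x [Kx xi]].
by apply: (adjacent_rank adj _ _ xi); apply: sK => //; apply: ltnW.
Qed.

End FlagGraphOfPolytope.

(** * Invariance under isomorphism and the characterisation of flag graphs *)

Lemma path_intersection_iso n (G H : cgraph n) : cgraph_iso G H ->
  path_intersection H -> path_intersection G.
Proof.
move=> [f [g [[f' fK f'K] [g' gK g'K] fg]]] piH.
have push I u v : reach I u v -> reach I (f u) (f v).
  move: u; apply: reach_ind => [|d dI _]; first exact: reach_refl.
  have [<- <- _ gc] := fg d; by apply: reach_cons; rewrite gc.
have pull I u v : reach I (f u) (f v) -> reach I u v.
  rewrite -{2}(fK u) -{2}(fK v); move: (f u).
  apply: reach_ind => [|e eI _]; first exact: reach_refl.
  have := fg (g' e); rewrite g'K => -[-> -> _ ec]; rewrite !fK.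
  by apply: reach_cons; rewrite -ec.
by move=> I J u v Iuv Juv; apply: pull; apply: piH; apply: push.
Qed.

Lemma polytope_flag_graphP n (M : maniplex n) :
  is_polytope_flag_graph M <-> path_intersection M.
Proof.
split=> [[disp [P [rk [polyP iso]]]]|pi].
  exact: path_intersection_iso iso (flag_graph_path_intersection polyP).
exists (Order.Disp tt tt), (face M), (@face_rk n M).
by split; [exact: maniplex_polytope | exact: maniplex_iso_flag_graph].
Qed.

(** * Paths of the derived graph and voltages *)

Section DerivedGraph.
Context {n : nat} {X : cgraph n} {Gamma : groupType} (xi : voltage X Gamma).
Implicit Types (x y : vertex X) (g h : Gamma).

(** Paths lift dart by dart; each voltage multiplies the group coordinate on the left, in the order
    of [path_volt]. *)
Lemma walk_derived x g y h (p : seq (dart X)) :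
  walk x p y -> h = (path_volt xi p * g)%g ->
  exists2 q : seq (dart (derived xi)), walk ((x, g) : vertex (derived xi)) q (y, h)
    & [seq d.1 | d <- q] = p.
Proof.
move=> + hE; subst h; elim: p x g => [|d p IHp] x g /=.
  by move=> ->; exists [::]; rewrite //= mul1g.
move=> [<- wp]; have [q wq qp] := IHp (term d) (xi d * g)%g wp.
by exists ((d, g) :: q); rewrite /= ?qp // -mulgA.
Qed.

Lemma walk_base (u v : vertex (derived xi)) (q : seq (dart (derived xi))) :
  walk u q v -> walk u.1 [seq d.1 | d <- q] v.1
    /\ v.2 = (path_volt xi [seq d.1 | d <- q] * u.2)%g.
Proof.
elim: q u => [|[d g] q IHq] u /=; first by move=> ->; rewrite mul1g.
by move=> [<- /IHq[wq ->]] /=; rewrite mulgA.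
Qed.

Lemma reach_derived (I : {set 'I_n}) x g y h :
  reach I ((x, g) : vertex (derived xi)) (y, h) <-> path_volts xi I x y (h * g^-1)%g.
Proof.
have cE (q : seq (dart (derived xi))) :
    colours_in I [seq d.1 | d <- q] = colours_in I q.
  by rewrite /colours_in all_map.
split=> [[q /walk_base[/= wq ->] qI]|[p [wp pI ph]]].
  by exists [seq d.1 | d <- q]; rewrite cE mulgK.
have [|q wq qp] := walk_derived (g := g) (h := h) wp; first by rewrite ph mulgVK.
by exists q; rewrite // -cE qp.
Qed.

Lemma path_volts_intersection :
  path_intersection (derived xi) <->
  forall (I J : {set 'I_n}) x y,
    (path_volts xi I x y `&` path_volts xi J x y)%classic = path_volts xi (I :&: J)%SET x y.
Proof.
(* For paths starting over the unit, the group coordinate of the end is the voltage itself. *)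
have voltE I x y g :
    path_volts xi I x y g <-> reach I ((x, 1%g) : vertex (derived xi)) (y, g).
  by rewrite reach_derived invg1 mulg1.
split=> [pi I J x y|pv I J [x g] [y h] /reach_derived Ixy /reach_derived Jxy]; last first.
  by apply/reach_derived; rewrite -pv.
apply/seteqP; split=> g; rewrite /= !voltE; first by case; apply: pi.
(* This inclusion always holds, by monotonicity in the colours. *)
by move=> xy; split; apply: reach_sub xy; [apply: subsetIl | apply: subsetIr].
Qed.

End DerivedGraph.

Theorem theorem4p1 (n : nat) (X : cgraph n) (Gamma : groupType)
    (xi : voltage X Gamma) (hX : is_premaniplex X)
    (hM : is_maniplex (derived xi)) :
  is_polytope_flag_graph (derived xi) <->
  forall (I J : {set 'I_n}) (x y : vertex X),
    (path_volts xi I x y `&` path_volts xi J x y)%classic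
      = path_volts xi (I :&: J)%SET x y.
Proof.
rewrite -path_volts_intersection.
exact: (polytope_flag_graphP (Maniplex hM)).
Qed.
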